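(* Let $G$ be an abelian group of order $n=4t+2$ (written additively, $t\ge1$), and let $D$ be a $k$-subset of $G$ with characteristic function $\chi:G\to\mathrm{GF}(2)$. Let $\phi(x)=(-1)^{\chi(x)}$ and $R=\{(\phi(g),g)\mid g\in G\}\subset\{\pm1\}\times G$. Then the following are equivalent: (i) $\partial\phi$ is quasi-orthogonal; (ii) $D$ is a $(4t+2,k,k-(t+1),(4t+1)(k-t)-k(k-1))$-almost difference set in $G$; (iii) $R$ is an extremal relative $(4t+2,2,4t+2,2t+1)$-quasi-difference set in $\{\pm1\}\times G$ with forbidden subgroup $\{\pm1\}\times\{0\}$; (iv) $\phi$ is an optimal binary array, i.e. $R_\phi(g)=\pm2$ for all $g\in G\setminus\{0\}$. If no difference set with parameters $\bigl(n,\frac{n\pm\sqrt{3n-2}}{2},\frac{n+2\pm2\sqrt{3n-2}}{4}\bigr)$ exists, then (i)–(iv) are further equivalent to (v) $\chi$ has optimal nonlinearity $(t+1)/(2t+1)$.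
   Context: $\partial\phi(x,y)=\phi(x)\phi(y)\phi(x+y)$; $R_\phi(g)=\sum_{x\in G}\phi(x)\phi(x+g)$. For a normalized cocycle $\psi:G\times G\to\{\pm1\}$ with matrix $M_\psi=[\psi(g,h)]_{g,h}$, the row excess is $RE(M_\psi)=\sum_{g\ne0}|\sum_h\psi(g,h)|$; a coboundary $\psi$ (such as $\partial\phi$) is quasi-orthogonal iff $RE(M_\psi)=8t+2$ (a non-coboundary is quasi-orthogonal iff $RE=4t$). A $(v,k,\lambda,s)$-almost difference set in $G$ ($|G|=v$) is a $k$-subset $D$ such that for $s$ of the nonzero $g\in G$ the number of pairs $(x,y)\in D^2$ with $x-y=g$ is $\lambda$, and for the remaining $v-1-s$ nonzero $g$ it is $\lambda+1$. Relative quasi-difference set: for a group $\mathcal E$ of order $8t+4$ and normal $Z\cong\mathbb Z_2$, a transversal $R$ for $Z$ in $\mathcal E$ containing $S\subset R\setminus\{1\}$ with $|S|\in\{0,2t+1\}$ such that for all $x\in\mathcal E\setminus Z$, $|R\cap xR|=2t+1$ if $x\in SZ$ and $|R\cap xR|\in\{2t,2t+2\}$ otherwise; extremal means $S=\emptyset$. Nonlinearity of $f:G\to\mathrm{GF}(2)$: $P_f=\max_{0\ne a\in G}\max_{b\in\mathrm{GF}(2)}|\{x\in G: f(x+a)-f(x)=b\}|/|G|$; for $|G|=4t+2$ the optimal value is $(t+1)/(2t+1)$. A $(v,k,\lambda)$-difference set is a $k$-subset of a group of order $v$ in which every nonidentity element has exactly $\lambda$ representations as a difference. *)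

(* Defs.v *)
From HB Require Import structures.
From mathcomp Require Import all_boot all_order all_algebra all_fingroup.
From mathcomp Require Import all_solvable all_field.
Set Implicit Arguments.
Unset Strict Implicit.
Unset Printing Implicit Defensive.
Import Order.TTheory GRing.Theory Num.Theory.
Local Open Scope ring_scope.

(* The multiplicative group {1, -1} of units of int. *)
Record pm1 := Pm1 { pm1_val :> int; pm1P : pm1_val \in [:: 1; -1] }.

HB.instance Definition _ := [isSub for pm1_val].
HB.instance Definition _ := [Countable of pm1 by <:].

Definition pm1_one : pm1 := @Pm1 1 isT.
Definition pm1_m1 : pm1 := @Pm1 (-1) isT.

Lemma pm1_enumP : Finite.axiom [:: pm1_one; pm1_m1].
Proof.
case=> x xP; rewrite /= -!val_eqE /=; move: xP; rewrite !inE.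
by case/orP=> /eqP->.
Qed.

HB.instance Definition _ := isFinite.Build pm1 pm1_enumP.

Lemma pm1_mul_subproof (a b : pm1) : (a : int) * (b : int) \in [:: 1; -1].
Proof.
case: a b => [a aP] [b bP] /=; move: aP bP; rewrite !inE.
by do 2![case/orP=> /eqP->].
Qed.

Definition pm1_mul (a b : pm1) : pm1 := Pm1 (pm1_mul_subproof a b).

Lemma pm1_mulA : associative pm1_mul.
Proof. by move=> a b c; apply: val_inj; rewrite /= mulrA. Qed.

Lemma pm1_mul1 : left_id pm1_one pm1_mul.
Proof. by move=> a; apply: val_inj; rewrite /= mul1r. Qed.

Lemma pm1_mulV : left_inverse pm1_one id pm1_mul.
Proof.
case=> a aP; apply: val_inj; move: aP; rewrite /= !inE.
by case/orP=> /eqP->.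
Qed.

HB.instance Definition _ := Finite_isGroup.Build pm1 pm1_mulA pm1_mul1 pm1_mulV.

Section AdditiveGroup.
Variable G : finZmodType.
Implicit Types (phi : G -> pm1) (psi : G -> G -> pm1) (D : {set G}).

Definition cobound phi : G -> G -> pm1 :=
  fun x y => (phi x * phi y * phi (x + y)%R)%g.

Definition autocorr phi (g : G) : int :=
  \sum_(x : G) (phi x : int) * (phi (x + g) : int).

Definition is_cocycle psi : Prop :=
  forall g h k : G,
    (psi g h * psi (g + h)%R k)%g = (psi g (h + k)%R * psi h k)%g.

Definition is_coboundary psi : Prop :=
  exists phi, forall x y, psi x y = cobound phi x y.

Definition row_excess psi : int :=
  \sum_(g : G | g != 0) `| \sum_(h : G) (psi g h : int) |.

(* For #|G| = 4t + 2.  Normalization of psi is not imposed: a binary cocycle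
   psi has psi g 0 = psi 0 g = psi 0 0 for all g, so it or its negation is
   normalized, and both have the same row excess; psi and its negation are
   also simultaneously coboundaries, as - 1 is the coboundary of - 1. *)
Definition quasi_orthogonal (t : nat) psi : Prop :=
  [/\ is_cocycle psi,
      is_coboundary psi -> row_excess psi = (8 * t + 2)%N%:Z
    & ~ is_coboundary psi -> row_excess psi = (4 * t)%N%:Z].

Definition num_diffs D (g : G) : nat :=
  #|[set p : G * G | [&& p.1 \in D, p.2 \in D & p.1 - p.2 == g]]|.

(* l and s are integers because the parameter formulas of interest, such as
   k - (t + 1), may be negative. *)
Definition almost_difference_set (v k : nat) (l s : int) D : Prop :=
  [/\ #|G| = v, #|D| = k,
      #|[set g : G | (g != 0) && ((num_diffs D g)%:Z == l)]|%:Z = s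
    & forall g : G, g != 0 ->
        (num_diffs D g)%:Z = l \/ (num_diffs D g)%:Z = l + 1].

Definition optimal_binary_array phi : Prop :=
  forall g : G, g != 0 -> autocorr phi g = 2 \/ autocorr phi g = - 2.

Definition charfun D : G -> 'F_2 := fun x => (x \in D)%:R.

Definition sign_fun D : G -> pm1 :=
  fun x => (pm1_m1 ^+ (charfun D x : nat))%g.

(* The default value 0 of the iterated maxima is harmless, all the ratios
   being nonnegative. *)
Definition nonlinearity (f : G -> 'F_2) : rat :=
  \big[Num.max/0]_(a : G | a != 0) \big[Num.max/0]_(b : 'F_2)
    (#|[set x : G | f (x + a) - f x == b]|%:R / #|G|%:R).

(* G is used here as a multiplicatively written group whose law is +. *)
Definition graph_set phi : {set pm1 * G} := [set (phi g, g) | g : G].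

Definition sign_subgroup : {group pm1 * G} :=
  [group of setX [set: pm1] [1 G]%g].

End AdditiveGroup.

(* The parameters are (4t + 2, 2, 4t + 2, 2t + 1), Z is the forbidden
   subgroup. *)
Definition relative_quasi_difference_set (E : finGroupType) (t : nat)
    (Z : {group E}) (R S : {set E}) : Prop :=
  [/\ #|E| = (8 * t + 4)%N,
      (Z <| [set: E])%g /\ (Z \isog [set: 'Z_2])%g,
      is_transversal R (rcosets Z [set: E]) [set: E],
      S \subset R :\ 1%g /\ (#|S| = 0%N \/ #|S| = (2 * t + 1)%N)
    & forall x : E, x \notin Z ->
        if x \in (S * Z)%g
        then #|R :&: (x *: R)%g| = (2 * t + 1)%N
        else #|R :&: (x *: R)%g| = (2 * t)%N
             \/ #|R :&: (x *: R)%g| = (2 * t + 2)%N].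

Definition extremal_relative_quasi_difference_set (E : finGroupType) (t : nat)
    (Z : {group E}) (R : {set E}) : Prop :=
  relative_quasi_difference_set t Z R set0.

Definition difference_set (H : finGroupType) (v k l : nat) (B : {set H}) :
    Prop :=
  [/\ #|H| = v, #|B| = k
    & forall g : H, g != 1%g ->
        #|[set p : H * H
            | [&& p.1 \in B, p.2 \in B & (p.1 * p.2^-1)%g == g]]| = l].

(* b selects the sign, the same in k and in l.  The square roots are taken in
   algC: when the two expressions are not natural numbers, no difference set
   can have them as parameters. *)
Definition exceptional_parameters (n : nat) (b : bool) (k l : nat) : Prop :=
  let r : algC := (-1) ^+ b * sqrtC (3 * n%:R - 2) in
  k%:R = (n%:R + r) / 2 :> algC /\ l%:R = (n%:R + 2 + 2 * r) / 4 :> algC.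

(* Main.v *)
Require Import Defs.
From HB Require Import structures.
From mathcomp Require Import all_boot all_order all_algebra all_fingroup.
From mathcomp Require Import all_solvable all_field zify ring lra.
Import Order.TTheory GRing.Theory FinRing.Theory Num.Theory.
Local Open Scope ring_scope.

(** Everything is read off the autocorrelation [A g] of [phi]. Expanding
    [phi = 1 - 2 * 1_D] gives [A g = |G| - 4 k + 4 N g], where [N g] is the
    number of representations of [g] as a difference in [D]. When
    [|G| = 4 t + 2] this makes [A g] congruent to [2] modulo [4], so [2] is the
    least possible value of [|A g|]. The row excess is the sum of the [|A g|],
    so [8 t + 2] is its minimum, attained when all of them are [2]; and
    [A g = -2, 2] means [N g = k - t - 1, k - t]. Finally, the number of [x]
    with [phi (x + g) = e phi x] is [(|G| + e A g) / 2]: it is both the size of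
    [R :&: (e, g) R] and the count maximized by the nonlinearity, and the
    larger of its values at [e = 1, -1] is at least [2 t + 2], with equality
    exactly when [|A g| = 2]. *)

Lemma prime_isog_Zp (gT : finGroupType) (H : {group gT}) :
  prime #|H| -> H \isog [set: 'Z_#|H|].
Proof.
move=> prH.
have cardZ : #|[set: 'Z_#|H|]| = #|H|.
  by rewrite cardsT card_ord Zp_cast ?prime_gt1.
by rewrite isog_cyclic_card !prime_cyclic ?cardZ ?eqxx.
Qed.

Lemma card_sum_indicator (T : finType) (A : {pred T}) :
  #|A|%:Z = \sum_x (x \in A)%:Z.
Proof.
rewrite -sum1_card -natz natr_sum big_mkcond.
by apply: eq_bigr => x _; case: (x \in A).
Qed.

Lemma sumz_const (T : finType) (x : int) : \sum_(i : T) x = #|T|%:Z * x.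
Proof. by rewrite sumr_const -mulr_natl natz. Qed.

Lemma sumz_const_neq (T : finType) (a : T) (x : int) :
  \sum_(i : T | i != a) x = (#|T|%:Z - 1) * x.
Proof.
have := sumz_const T x.
by rewrite (bigD1 a) //= => /(canRL (addKr _)) ->; ring.
Qed.

Lemma pm1_eqVeq (e : pm1) : e = pm1_one \/ e = pm1_m1.
Proof.
case: e => x xP; have := xP; rewrite !inE.
by case/orP=> /eqP eq_x; [left | right]; apply: val_inj.
Qed.

Lemma card_pm1 : #|{: pm1}| = 2%N.
Proof. by rewrite cardE enumT unlock. Qed.

Lemma pm1_sqr (e : pm1) : (e : int) * e = 1.
Proof. by case: (pm1_eqVeq e) => ->. Qed.

Lemma pm1_eq_indicator (a b : pm1) : 2 * (a == b)%:Z = 1 + (a : int) * b.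
Proof. by case: (pm1_eqVeq a) (pm1_eqVeq b) => -> [] ->. Qed.

Definition sgn (b : 'F_2) : pm1 := (pm1_m1 ^+ (b : nat))%g.

Lemma sgnD : {morph sgn : a b / a + b >-> (a * b)%g}.
Proof. by do 2![case=> [[|[|//]] ?]]; apply: val_inj. Qed.

Lemma sgn_inj : injective sgn.
Proof. by do 2![case=> [[|[|//]] ?]] => // _; apply: val_inj. Qed.

Lemma sgn_surj (e : pm1) : exists b, e = sgn b.
Proof. by case: (pm1_eqVeq e) => ->; [exists 0 | exists 1]. Qed.

Section FiniteAbelianGroup.
Variable G : finZmodType.
Implicit Types (phi : G -> pm1) (f : G -> 'F_2) (D : {set G}) (g : G) (e : pm1).

Definition agreements phi e g : {set G} :=
  [set x | phi (x + g) == (e * phi x)%g].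

Lemma card_agreements phi e g :
  2 * #|agreements phi e g|%:Z = #|G|%:Z + (e : int) * autocorr phi g.
Proof.
rewrite card_sum_indicator /autocorr !mulr_sumr.
rewrite -[#|G|%:Z]mulr1 -sumz_const -big_split; apply: eq_bigr => x _.
by rewrite inE pm1_eq_indicator /=; ring.
Qed.

Section NumDiffs.
Variable D : {set G}.

Lemma num_diffsE g : num_diffs D g = #|[set x in D | x + g \in D]|.
Proof.
rewrite -(card_imset _ (_ : injective (fun x => (x + g, x)))); last first.
  by move=> x y [].
apply: eq_card => -[x y]; rewrite !inE /=; apply/and3P/imsetP => [|[z]].
  case=> Dx Dy /eqP <-; exists y; rewrite ?inE addrC subrK //.
  by rewrite Dy.
by rewrite inE => /andP[Dz Dzg] [-> ->]; rewrite Dz Dzg addrC addKr.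
Qed.

Lemma num_diffs_sum g :
  (num_diffs D g)%:Z = \sum_x (x \in D)%:Z * (x + g \in D)%:Z.
Proof.
rewrite num_diffsE card_sum_indicator.
by apply: eq_bigr => x _; rewrite inE -mulnb PoszM.
Qed.

Lemma num_diffs0 : num_diffs D 0 = #|D|.
Proof. by rewrite num_diffsE; apply: eq_card => x; rewrite inE addr0 andbb. Qed.

Lemma sum_num_diffs : (\sum_g num_diffs D g = #|D| * #|D|)%N.
Proof.
rewrite -cardsX -sum1_card (partition_big (fun p => p.1 - p.2) predT) //=.
apply: eq_bigr => g _; rewrite /num_diffs -sum1_card; apply: eq_bigl => p.
by rewrite !inE andbA.
Qed.

Lemma sum_num_diffs_neq0 :
  \sum_(g : G | g != 0) (num_diffs D g)%:Z = #|D|%:Z * (#|D|%:Z - 1).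
Proof.
rewrite -(big_morph Posz PoszD (erefl _)).
have /(congr1 Posz) := sum_num_diffs; rewrite (bigD1 0) //= num_diffs0.
by rewrite PoszD PoszM => /(canRL (addKr _)) ->; ring.
Qed.

(* Summing over [g != 0] shows that the parameter [s] of an almost difference
   set is determined by the other three. *)
Lemma almost_difference_setP (l : int) :
  almost_difference_set #|G| #|D| l
    ((#|G|%:Z - 1) * (l + 1) - #|D|%:Z * (#|D|%:Z - 1)) D
  <-> forall g, g != 0 ->
        (num_diffs D g)%:Z = l \/ (num_diffs D g)%:Z = l + 1.
Proof.
split=> [[]//|ads]; split=> //.
rewrite -sum_num_diffs_neq0 -(sumz_const_neq _ 0) -sumrB card_sum_indicator.
rewrite [RHS]big_mkcond; apply: eq_bigr => g _; rewrite inE.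
by have [//|/= /ads] := eqVneq g 0; case: eqP => [->|_ [//|->]] *; lia.
Qed.

End NumDiffs.

Definition negset phi : {set G} := [set x | phi x == pm1_m1].

Lemma negset_sign_fun D : negset (sign_fun D) = D.
Proof.
by apply/setP => x; rewrite inE /sign_fun /charfun; case: (x \in D).
Qed.

Lemma pm1_negset phi x : (phi x : int) = 1 - 2 * (x \in negset phi)%:Z.
Proof. by rewrite inE; case: (pm1_eqVeq (phi x)) => ->. Qed.

Lemma autocorr_num_diffs phi g :
  autocorr phi g
    = #|G|%:Z - 4 * #|negset phi|%:Z + 4 * (num_diffs (negset phi) g)%:Z.
Proof.
set D := negset phi.
have cardD_shift : #|D|%:Z = \sum_x (x + g \in D)%:Z.
  by rewrite card_sum_indicator (reindex_inj (addIr g)).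
transitivity (#|G|%:Z * 1 - 2 * #|D|%:Z - 2 * #|D|%:Z
              + 4 * (num_diffs D g)%:Z); last by ring.
rewrite {1}card_sum_indicator cardD_shift num_diffs_sum.
rewrite -sumz_const !mulr_sumr -!sumrB -big_split; apply: eq_bigr => x _ /=.
by rewrite !pm1_negset -/D; ring.
Qed.

Lemma cobound_cocycle phi : is_cocycle (cobound phi).
Proof.
move=> g h k; apply: val_inj; rewrite /= addrA.
pose p := (phi g * phi h * phi k * phi (g + h + k))%g : int.
transitivity ((phi (g + h) : int) * phi (g + h) * p);
  first by rewrite /p /=; ring.
transitivity ((phi (h + k) : int) * phi (h + k) * p);
  last by rewrite /p /=; ring.
by rewrite !pm1_sqr.
Qed.

Lemma row_excess_cobound phi :
  row_excess (cobound phi) = \sum_(g : G | g != 0) `|autocorr phi g|.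
Proof.
apply: eq_bigr => g _.
have -> : \sum_h (cobound phi g h : int) = (phi g : int) * autocorr phi g.
  by rewrite mulr_sumr; apply: eq_bigr => h _; rewrite /= mulrA (addrC g).
by case: (pm1_eqVeq (phi g)) => ->; rewrite ?mul1r // mulN1r normrN.
Qed.

Lemma quasi_orthogonal_cobound t phi :
  quasi_orthogonal t (cobound phi)
    <-> row_excess (cobound phi) = (8 * t + 2)%N%:Z.
Proof.
have cob : is_coboundary (cobound phi) by exists phi.
by split=> [[_ ->]//|re]; split=> //; apply: cobound_cocycle.
Qed.

Lemma optimal_binary_array_normP phi :
  optimal_binary_array phi <-> forall g, g != 0 -> `|autocorr phi g| = 2.
Proof. by split=> opt g /opt; lia. Qed.

Lemma mem_sign_subgroup (x : pm1 * G) : (x \in sign_subgroup G) = (x.2 == 0).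
Proof. by rewrite !inE. Qed.

Lemma sign_subgroup_normal : (sign_subgroup G <| [set: pm1 * G])%g.
Proof.
have -> : [set: pm1 * G] = setX [set: pm1] [set: G].
  by apply/setP => x; rewrite !inE.
by have /dprod_normal2[] := setX_dprod [set: pm1] [set: G].
Qed.

Lemma sign_subgroup_isog : (sign_subgroup G \isog [set: 'Z_2])%g.
Proof.
have cardZ : #|sign_subgroup G| = 2%N by rewrite cardsX cardsT card_pm1 cards1.
by have := prime_isog_Zp _ (sign_subgroup G); rewrite cardZ; apply.
Qed.

Lemma mem_graph_set phi (x : pm1 * G) :
  (x \in graph_set phi) = (x.1 == phi x.2).
Proof.
apply/imsetP/eqP => [[g _ -> //]|eq_x]; exists x.2 => //.
by rewrite -eq_x -surjective_pairing.
Qed.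

Lemma graph_set_transversal phi :
  is_transversal (graph_set phi) (rcosets (sign_subgroup G) [set: pm1 * G])
    [set: pm1 * G].
Proof.
rewrite /is_transversal rcosets_partition ?subsetT //=.
apply/forall_inP => B /rcosetsP[[e g] _ ->].
apply/cards1P; exists (phi g, g); apply/setP => -[e' g'].
rewrite in_setI mem_graph_set mem_rcoset mem_sign_subgroup in_set1 /=.
rewrite xpair_eqE zmodMgE zmodVgE subr_eq0.
by have [->|_] := eqVneq g' g; rewrite ?andbF.
Qed.

Lemma card_graph_set_lcoset phi e g :
  #|graph_set phi :&: ((e, g) *: graph_set phi)%g| = #|agreements phi e g|.
Proof.
rewrite -(card_imset _ (_ : injective (fun x : G => (phi (x + g), x + g))));
  last by move=> x y [_ /addIr].
apply: eq_card => -[e' y].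
rewrite inE mem_lcoset !mem_graph_set /= zmodMgE zmodVgE addrC.
apply/andP/imsetP => [[/eqP -> /eqP eq_phi]|[x]].
  exists (y - g); rewrite ?subrK // inE subrK.
  by rewrite -eq_phi mulKVg.
by rewrite inE => /eqP eq_phi [-> ->]; rewrite addrK eq_phi mulKg.
Qed.

Lemma derivative_fiberE f a b :
  [set x | f (x + a) - f x == b] = agreements (sgn \o f) (sgn b) a.
Proof. by apply/setP => x; rewrite !inE subr_eq -sgnD (inj_eq sgn_inj). Qed.

Lemma agreements_le_nonlinearity f e a : a != 0 ->
  #|agreements (sgn \o f) e a|%:R / #|G|%:R <= nonlinearity f.
Proof.
move=> a0; have [b ->] := sgn_surj e; rewrite -derivative_fiberE.
apply: (bigmax_sup a) => //.
exact: (le_bigmax _ (fun b => #|[set x | f (x + a) - f x == b]|%:R / _)).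
Qed.

Lemma nonlinearity_leP f (n : nat) :
  nonlinearity f <= n%:R / #|G|%:R
  <-> forall e a, a != 0 -> (#|agreements (sgn \o f) e a| <= n)%N.
Proof.
have leG m : (m%:R / #|G|%:R <= n%:R / #|G|%:R :> rat) = (m <= n)%N.
  rewrite ler_pM2r ?ler_nat // invr_gt0 ltr0n.
  by apply/card_gt0P; exists 0.
split=> [le_nl e a a0 | le_n].
  by rewrite -leG (le_trans (agreements_le_nonlinearity f e a a0)).
have ge0 : 0 <= n%:R / #|G|%:R :> rat by rewrite divr_ge0 ?ler0n.
apply: bigmax_le => // a a0; apply: bigmax_le => // b _.
by rewrite leG derivative_fiberE le_n.
Qed.

Section OrderTwoModFour.
Variable t : nat.
Hypothesis cardG : #|G| = (4 * t + 2)%N.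

Lemma autocorr_norm_ge2 phi g : 2 <= `|autocorr phi g|.
Proof. by rewrite autocorr_num_diffs cardG; lia. Qed.

Lemma row_excess_cobound_leif phi :
  (8 * t + 2)%N%:Z <= row_excess (cobound phi)
    ?= iff [forall (g | g != 0), 2 == `|autocorr phi g|].
Proof.
have -> : (8 * t + 2)%N%:Z = \sum_(g : G | g != 0) 2.
  by rewrite sumz_const_neq cardG; lia.
rewrite row_excess_cobound; apply: leif_sum => g _.
exact/leif_eq/autocorr_norm_ge2.
Qed.

Lemma quasi_orthogonal_coboundP phi :
  quasi_orthogonal t (cobound phi) <-> optimal_binary_array phi.
Proof.
rewrite quasi_orthogonal_cobound optimal_binary_array_normP.
have eq_re := (row_excess_cobound_leif phi).2.
split=> [re g g0 | opt].
  by move: eq_re; rewrite re eqxx => /esym/forall_inP/(_ g g0)/eqP.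
by apply/esym/eqP; rewrite eq_re; apply/forall_inP => g /opt ->.
Qed.

Lemma almost_difference_set_optimalP D :
  let k := #|D| in
  almost_difference_set (4 * t + 2) k (k%:Z - (t%:Z + 1))
    ((4 * t%:Z + 1) * (k%:Z - t%:Z) - k%:Z * (k%:Z - 1)) D
  <-> optimal_binary_array (sign_fun D).
Proof.
move=> k; set l := k%:Z - (t%:Z + 1).
have -> : (4 * t%:Z + 1) * (k%:Z - t%:Z) = (#|G|%:Z - 1) * (l + 1).
  by rewrite cardG; congr (_ * _); lia.
rewrite -cardG almost_difference_setP.
by split=> opt g /opt; rewrite autocorr_num_diffs negset_sign_fun cardG; lia.
Qed.

Lemma optimal_binary_array_agreementsP phi :
  optimal_binary_array phi
  <-> forall e g, g != 0 ->
        #|agreements phi e g| = (2 * t)%N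
        \/ #|agreements phi e g| = (2 * t + 2)%N.
Proof.
split=> [opt e g g0 | agree g g0].
  have := card_agreements phi e g; rewrite cardG.
  by case: (pm1_eqVeq e) (opt g g0) => -> [] -> /=; lia.
have := agree pm1_one g g0; have := card_agreements phi pm1_one g.
by rewrite cardG mul1r; lia.
Qed.

Lemma optimal_binary_array_agreements_leP phi :
  optimal_binary_array phi
  <-> forall e g, g != 0 -> (#|agreements phi e g| <= 2 * t + 2)%N.
Proof.
split=> [/optimal_binary_array_agreementsP agree e g g0 | agree_le g g0].
  by case: (agree e g g0) => ->; lia.
have := card_agreements phi pm1_one g; have := card_agreements phi pm1_m1 g.
have := agree_le pm1_one g g0; have := agree_le pm1_m1 g g0.
by have := autocorr_norm_ge2 phi g; rewrite cardG /=; lia.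
Qed.

Lemma extremal_graph_set_optimalP phi :
  extremal_relative_quasi_difference_set t (sign_subgroup G) (graph_set phi)
  <-> optimal_binary_array phi.
Proof.
split=> [[_ _ _ _ qds] | /optimal_binary_array_agreementsP agree].
  apply/optimal_binary_array_agreementsP => e g g0.
  have := qds (e, g).
  by rewrite mem_sign_subgroup mul0g inE card_graph_set_lcoset => /(_ g0).
split.
- by rewrite card_prod card_pm1 cardG; lia.
- by split; [apply: sign_subgroup_normal | apply: sign_subgroup_isog].
- exact: graph_set_transversal.
- by rewrite sub0set cards0; split; [|left].
- case=> e g; rewrite mem_sign_subgroup mul0g inE card_graph_set_lcoset.
  exact: agree.
Qed.

Lemma exists_agreements_ge phi g :
  exists e, (2 * t + 2 <= #|agreements phi e g|)%N.
Proof.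
have := card_agreements phi pm1_one g; have := card_agreements phi pm1_m1 g.
rewrite cardG /= => agreeN agree1; have := autocorr_norm_ge2 phi g.
have [A0|A0] := leP 0 (autocorr phi g) => A2.
  by exists pm1_one; lia.
by exists pm1_m1; lia.
Qed.

Lemma nonlinearity_ge f : (2 * t + 2)%N%:R / #|G|%:R <= nonlinearity f.
Proof.
have /card_gt0P[a a0] : (0 < #|predC1 (0%R : G)|)%N.
  by rewrite cardC1 cardG; lia.
have [e agree_ge] := exists_agreements_ge (sgn \o f) a.
apply: le_trans (agreements_le_nonlinearity f e a a0).
by rewrite ler_wpM2r ?invr_ge0 ?ler0n // ler_nat.
Qed.

Lemma optimal_nonlinearityE :
  (t%:R + 1) / (2 * t%:R + 1) = (2 * t + 2)%N%:R / #|G|%:R :> rat.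
Proof.
have t0 := ler0n rat t.
rewrite cardG (natrD _ (2 * t)) (natrD _ (4 * t)) !natrM; field.
by apply/andP; split; apply: lt0r_neq0; lra.
Qed.

Lemma optimal_nonlinearityP f :
  nonlinearity f = (t%:R + 1) / (2 * t%:R + 1)
  <-> optimal_binary_array (sgn \o f).
Proof.
rewrite optimal_nonlinearityE optimal_binary_array_agreements_leP.
rewrite -nonlinearity_leP; split=> [-> // | le_nl].
by apply/le_anti; rewrite le_nl nonlinearity_ge.
Qed.

End OrderTwoModFour.

End FiniteAbelianGroup.

Theorem theorem4 (t : nat) (ht : (1 <= t)%N)
    (G : finZmodType) (hG : #|G| = (4 * t + 2)%N)
    (k : nat) (D : {set G}) (hD : #|D| = k) :
  let n := (4 * t + 2)%N in
  let chi := charfun D in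
  let phi := sign_fun D in
  let R := graph_set phi in
  let i := quasi_orthogonal t (cobound phi) in
  let ii := almost_difference_set (4 * t + 2) k
              (k%:Z - (t%:Z + 1))
              ((4 * t%:Z + 1) * (k%:Z - t%:Z) - k%:Z * (k%:Z - 1)) D in
  let iii := extremal_relative_quasi_difference_set t (sign_subgroup G) R in
  let iv := optimal_binary_array phi in
  let v := nonlinearity chi = (t%:R + 1) / (2 * t%:R + 1) in
  [<-> i; ii; iii; iv] /\
  ((forall (b : bool) (k' l' : nat), exceptional_parameters n b k' l' ->
      forall (H : finGroupType) (B : {set H}), ~ difference_set n k' l' B) ->
   [<-> i; ii; iii; iv; v]).
Proof.
move=> n chi phi R i ii iii iv v; subst k.
have i_iv : i <-> iv by apply: quasi_orthogonal_coboundP.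
have ii_iv : ii <-> iv by apply: almost_difference_set_optimalP.
have iii_iv : iii <-> iv by apply: extremal_graph_set_optimalP.
have v_iv : v <-> iv by apply: optimal_nonlinearityP.
by split=> [|_]; tfae; tauto.
Qed.
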